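(* Assume the following uniform quantitative prime $K$-tuples conjecture. For a finite set $\mathcal{L}=\{L_1,\dots,L_K\}$ of distinct linear forms $L_k(n)=a_kn+b_k$ with positive integer coefficients $a_k,b_k$, let $\omega_{\mathcal{L}}(p)$ denote the number of roots of $\prod_{k=1}^K L_k(n)$ modulo a prime $p$; call $\mathcal{L}$ admissible if $\omega_{\mathcal{L}}(p)<p$ for every prime $p$, and define the singular series $$\mathfrak{S}(\mathcal{L})=\prod_p\Big(1-\frac{\omega_{\mathcal{L}}(p)}{p}\Big)\Big(1-\frac1p\Big)^{-K}.$$ The assumption is: there is a function $\varepsilon(x)\to 0$ as $x\to\infty$ such that for all sufficiently large $x$ and every admissible set $\mathcal{L}$ of $K$ distinct linear forms with $K\le 100\log\log\log x$ and all $a_k,b_k\le(\log\log x)^{100}$, $$\#\{n\le x:\ L_k(n)\text{ is prime for all }1\le k\le K\}=(1+\varepsilon_{\mathcal{L}}(x))\,\mathfrak{S}(\mathcal{L})\frac{x}{(\log x)^K}\quad\text{with }|\varepsilon_{\mathcal{L}}(x)|\le\varepsilon(x).$$ Under this assumption, for every integer $t\ge 2$ the number $$\sum_{n\ge1}\frac{\omega(n)}{t^n}$$ is irrational, where $\omega(n)$ denotes the number of distinct prime factors of $n$.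
   Context: $\omega(n)$ is the number of distinct prime divisors of the positive integer $n$. The product in the singular series runs over all primes $p$. *)

(* Defs.v *)
From HB Require Import structures.
From mathcomp Require Import all_boot all_order all_algebra.
From mathcomp Require Import all_classical all_reals all_analysis.

Set Implicit Arguments.
Unset Strict Implicit.
Unset Printing Implicit Defensive.

Import Order.TTheory GRing.Theory Num.Theory.
Import numFieldNormedType.Exports.

Local Open Scope classical_set_scope.
Local Open Scope ring_scope.

(* The pair (a, b) encodes the linear form n |-> a n + b. *)
Definition linform : Type := (nat * nat)%type.

Definition form_eval (f : linform) (n : nat) : nat := (f.1 * n + f.2)%N.

(* A finite set of distinct forms is a duplicate-free sequence, K its size. *)
Definition form_set (L : seq linform) : Prop :=
  uniq L /\ forall f, f \in L -> (0 < f.1)%N /\ (0 < f.2)%N.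

Definition nroots (L : seq linform) (p : nat) : nat :=
  #|[pred n : 'I_p | (p %| \prod_(f <- L) form_eval f n)%N]|.

Definition admissible (L : seq linform) : Prop :=
  forall p : nat, prime p -> (nroots L p < p)%N.

(* The primes are taken in increasing order. *)
Definition singular_series (R : realType) (L : seq linform) : R :=
  limn (fun N : nat => \prod_(0 <= p < N | prime p)
    ((1 - (nroots L p)%:R / p%:R) * (1 - p%:R^-1) ^- size L : R)).

(* Here n ranges over the positive integers n <= x. *)
Definition prime_tuple_count (R : realType) (L : seq linform) (x : R) : nat :=
  count (fun n => all (fun f => prime (form_eval f n)) L)
    (index_iota 1 (Num.truncn x).+1).

Definition prime_tuples_conjecture (R : realType) : Prop :=
  exists eps : R -> R,
    eps x @[x --> +oo] --> (0 : R) /\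
    \forall x \near +oo, forall L : seq linform,
      form_set L -> (0 < size L)%N -> admissible L ->
      (size L)%:R <= 100 * ln (ln (ln x)) ->
      (forall f, f \in L ->
        f.1%:R <= ln (ln x) ^+ 100 /\ f.2%:R <= ln (ln x) ^+ 100) ->
      exists e : R, `|e| <= eps x /\
        (prime_tuple_count L x)%:R =
          (1 + e) * singular_series R L * (x / ln x ^+ size L).

(* primes n lists each prime divisor of n once. *)
Definition omega (n : nat) : nat := size (primes n).

(* Main.v *)
(* Suppose S = sum omega(n)/t^n = a/b.  Multiplying by t^n shows that
   b T_n is an integer for T_n = sum_(k >= 1) omega(n+k)/t^k and every n, and
   T_0 = S.  Fix k0 with 2 b (t-1) < t^k0, let Q be a multiple of 1, ..., K of
   size at most 4^K, let P be a prime factor of Q + 1, hence P > K, and put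
   n = Q (P m + k0).  Then n + k = k L_k(m) for k <= K, k <> k0, and
   n + k0 = k0 P L_k0(m), where the L_k form an admissible set of linear forms.
   When all L_k(m) are prime, T_n - T_0 - 1/(t-1) is t^(-k0) up to the
   contribution of k > K, and as soon as this contribution is small,
   b (t-1) (T_n - T_0 - 1/(t-1)) is an integer strictly between 0 and 1.

   Take x = 2^2^y with y = 3^(K/2).  By the conjecture the proportion of good
   m <= x is at least 2^(-y(K+1)-2).  As sum_(v <= x) 2^omega(v) <= sum_(v <= x) d(v)
   is about x log x, the proportion of the m such that omega(n+k) > Y := y(K+6)
   for some k up to about log x is of smaller order, so a union bound
   produces an m for which all L_k(m) are prime and omega(n+k) <= Y + k for all
   k.  The tail is then O(Y/2^K), which tends to 0 because sqrt 3 < 2. *)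

Require Import Defs.
From mathcomp Require Import all_boot all_order all_algebra.
From mathcomp Require Import all_classical all_reals all_analysis.
From mathcomp Require Import zify ring lra.

Import Order.TTheory GRing.Theory Num.Theory.
Import numFieldNormedType.Exports.

Local Open Scope classical_set_scope.
Local Open Scope ring_scope.

(** * Divisor sums, large values of [omega], and small common multiples *)

Section PrimeFactors.

Local Open Scope nat_scope.

(** Let [w] be the part of [v] prime to its divisor [p]. The divisors of [w] and their products with
    [p] are disjoint families of divisors of [v], so each prime at least doubles the count. *)
Lemma expn_omega_le_divisors v : 0 < v -> 2 ^ omega v <= size (divisors v).
Proof.
rewrite /omega; elim/ltn_ind: v => v IH v0.
have [v1|v1] := leqP v 1; first by have -> : v = 1 by lia.
have pp := pdiv_prime v1; set p := pdiv v in pp.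
have pv : p %| v by apply: pdiv_dvd.
set w := v`_p^'.
have w0 : 0 < w by apply: part_gt0.
have wv : w %| v by apply: dvdn_part.
have pw : ~~ (p %| w) by rewrite -p'natE //; apply: part_pnat.
have wlt : w < v.
  rewrite ltn_neqAle dvdn_leq // andbT; apply/eqP => E.
  by move: pw; rewrite E pv.
have pwv : p * w %| v by rewrite Gauss_dvd ?pv // prime_coprime.
have sP : size (primes v) = (size (primes w)).+1.
  rewrite /w primes_part size_filter.
  have -> : count [in p^'] (primes v) = count (predC (pred1 p)) (primes v).
    by apply: eq_count => q; rewrite /= !inE.
  rewrite -(count_predC (pred1 p) (primes v)) count_uniq_mem ?primes_uniq //.
  by rewrite mem_primes pp v0 pv add1n.
rewrite sP expnS mul2n -addnn.
apply: (leq_trans (leq_add (IH _ wlt w0) (IH _ wlt w0))).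
rewrite -[X in _ + X](size_map (muln p)) -size_cat.
apply: uniq_leq_size.
  rewrite cat_uniq divisors_uniq map_inj_uniq ?divisors_uniq ?andbT /=; last first.
    by move=> a b /eqP; rewrite eqn_pmul2l ?prime_gt0 // => /eqP.
  apply/hasPn => _ /mapP[d _ ->]; rewrite -dvdn_divisors //.
  by apply: contra pw; apply: dvdn_trans; apply: dvdn_mulr.
move=> d; rewrite mem_cat -!dvdn_divisors // => /orP[dw|/mapP[e]].
  exact: dvdn_trans wv.
rewrite -dvdn_divisors // => ew ->.
by apply: dvdn_trans pwv; rewrite dvdn_pmul2l ?prime_gt0.
Qed.

Lemma size_divisors n v : 0 < v <= n ->
  size (divisors v) = \sum_(1 <= d < n.+1) (d %| v).
Proof.
move=> /andP[v0 vn].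
have -> : \sum_(1 <= d < n.+1) (d %| v) = count (dvdn^~ v) (index_iota 1 n.+1).
  by rewrite -sum1_count [RHS]big_mkcond /=; apply: eq_bigr => d _; case: (_ %| _).
rewrite -size_filter; apply/perm_size/uniq_perm.
- exact: divisors_uniq.
- by rewrite filter_uniq // iota_uniq.
move=> d; rewrite mem_filter mem_index_iota -dvdn_divisors //.
case dv: (d %| v) => //=; rewrite ltnS (leq_trans (dvdn_leq v0 dv)) // andbT.
by rewrite (dvdn_gt0 v0 dv).
Qed.

Lemma sum_size_divisors n :
  \sum_(1 <= v < n.+1) size (divisors v) = \sum_(1 <= d < n.+1) n %/ d.
Proof.
under eq_big_nat => v /andP[v0 vn] do rewrite (@size_divisors n) ?v0 //.
rewrite exchange_big /=; apply: eq_bigr => d _.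
by rewrite divn_count_dvd.
Qed.

(* Pairing up: floor (2n/d) <= 2 floor (n/d) + 1, and floor (2n/d) = 1 for
   n < d <= 2n. *)
Lemma sum_divn_pow2 h :
  \sum_(1 <= d < (2 ^ h).+1) 2 ^ h %/ d <= 2 ^ h * h.+1.
Proof.
elim: h => [|h IH]; first by rewrite big_nat1.
set n := 2 ^ h in IH *; have n0 : 0 < n by rewrite expn_gt0.
have -> : 2 ^ h.+1 = n + n by rewrite expnS mul2n addnn.
rewrite (@big_cat_nat _ _ _ n.+1) //=; last by rewrite ltnS leq_addr.
have le1 : \sum_(1 <= d < n.+1) (n + n) %/ d
           <= \sum_(1 <= d < n.+1) (2 * (n %/ d) + 1).
  rewrite big_nat [leqRHS]big_nat; apply: leq_sum => d /andP[d0 _].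
  rewrite -ltnS ltn_divLR //.
  have := divn_eq n d; have := ltn_pmod n d0; nia.
have le2 : \sum_(n.+1 <= d < (n + n).+1) (n + n) %/ d
           <= \sum_(n.+1 <= d < (n + n).+1) 1.
  rewrite big_nat [leqRHS]big_nat; apply: leq_sum => d /andP[d0 _].
  by rewrite -ltnS ltn_divLR; lia.
apply: leq_trans (leq_add le1 le2) _.
rewrite big_split /= -big_distrr /= !sum_nat_const_nat.
by move: IH; nia.
Qed.

(** Markov's inequality for [2 ^ omega v], whose sum is at most the divisor sum. *)
Lemma count_omega_gt h Y :
  count (fun v => Y < omega v) (index_iota 1 (2 ^ h).+1) * 2 ^ Y
    <= 2 ^ h * h.+1.
Proof.
apply: leq_trans (sum_divn_pow2 h); rewrite -sum_size_divisors.
rewrite -sum1_count big_distrl /= big_mkcond /= big_nat [leqRHS]big_nat.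
apply: leq_sum => v /andP[v0 _]; case: ifP => // Yv.
rewrite mul1n; apply: leq_trans (expn_omega_le_divisors v v0).
by rewrite leq_exp2l // ltnW.
Qed.

Lemma omega_le_log v k : v <= 2 ^ k -> omega v <= k.
Proof.
have [->//|v0 vk] := posnP v.
rewrite -(@leq_exp2l 2) //; apply: leq_trans (expn_omega_le_divisors v v0) _.
apply: leq_trans vk; rewrite -[leqRHS](size_iota 1); apply: uniq_leq_size.
  exact: divisors_uniq.
move=> d; rewrite -dvdn_divisors // mem_iota add1n ltnS => dv.
by rewrite (dvdn_gt0 v0 dv) dvdn_leq.
Qed.

Lemma omega_mul_prime k q : 0 < k -> prime q -> ~~ (q %| k) ->
  omega (k * q) = (omega k).+1.
Proof.
move=> k0 pq qk; rewrite /omega.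
rewrite -[RHS]/(size (q :: primes k)); apply/perm_size/uniq_perm.
- exact: primes_uniq.
- by rewrite /= primes_uniq mem_primes (negPf qk) !andbF.
by move=> p; rewrite primesM ?(prime_gt0 pq) // (primes_prime pq) !inE orbC.
Qed.

Lemma omega_le_self k : omega k <= k.
Proof. by apply: omega_le_log; apply/ltnW/ltn_expl. Qed.

(* A prime power in (n, 2n] has quotient 2n/q odd, so its prime divides the
   central binomial coefficient. *)
Lemma prime_dvd_central_bin n p e : prime p -> 0 < e -> n < p ^ e <= 2 * n ->
  p %| 'C(2 * n, n).
Proof.
move=> pp e0 /andP[nq q2n].
have n2n : n <= 2 * n by lia.
have C0 : 0 < 'C(2 * n, n) by rewrite bin_gt0.
have := congr1 (logn p) (bin_fact n2n).
rewrite (_ : 2 * n - n = n); last by lia.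
rewrite !lognM ?muln_gt0 ?fact_gt0 // !logn_fact //.
have e2n : e < (2 * n).+1 by rewrite ltnS (leq_trans _ q2n) // ltnW // ltn_expl ?prime_gt1.
have -> : \sum_(1 <= k < n.+1) n %/ p ^ k = \sum_(1 <= k < (2 * n).+1) n %/ p ^ k.
  rewrite [RHS](@big_cat_nat _ _ _ n.+1) //=.
  rewrite [X in _ = _ + X](_ : _ = 0) ?addn0 // big_nat big1 // => k /andP[nk _].
  apply: divn_small.
  by apply: (leq_trans nk); apply/ltnW/ltn_expl/prime_gt1.
move=> E.
suff : 0 < logn p 'C(2 * n, n) by rewrite logn_gt0 mem_primes => /and3P[].
suff : \sum_(1 <= k < (2 * n).+1) n %/ p ^ k + \sum_(1 <= k < (2 * n).+1) n %/ p ^ k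
    < \sum_(1 <= k < (2 * n).+1) (2 * n) %/ p ^ k by move: E; lia.
have S F : \sum_(1 <= k < (2 * n).+1) F k =
    \sum_(1 <= k < e) F k + (F e + \sum_(e.+1 <= k < (2 * n).+1) F k).
  by rewrite (@big_cat_nat _ _ _ e) ?(ltnW e2n) //= (@big_ltn _ _ _ e).
rewrite -big_split /= !S.
have dv k : n %/ p ^ k + n %/ p ^ k <= (2 * n) %/ p ^ k.
  have q0 : 0 < p ^ k by rewrite expn_gt0 prime_gt0.
  by rewrite leq_divRL //; have := leq_divM n (p ^ k); lia.
have -> : n %/ p ^ e = 0 by apply: divn_small.
have : 0 < (2 * n) %/ p ^ e by rewrite divn_gt0 ?expn_gt0 ?prime_gt0.
have sdv r : \sum_(k <- r) (n %/ p ^ k + n %/ p ^ k)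
    <= \sum_(k <- r) (2 * n) %/ p ^ k by apply: leq_sum => k _.
have := sdv (index_iota 1 e); have := sdv (index_iota e.+1 (2 * n).+1).
by lia.
Qed.

Lemma bin_le_exp2 n m : 'C(n, m) <= 2 ^ n.
Proof.
elim: n m => [|n IH] [|m]; rewrite ?bin0 ?bin0n ?expn_gt0 //.
by rewrite binS expnS mul2n -addnn leq_add.
Qed.

(** Passing from [n] to [2n] multiplies [Q] by the central binomial coefficient, which is at most
    [4 ^ n]; this is why the range runs over powers of two. *)
Lemma small_common_multiple j : exists Q, [/\ 0 < Q, Q <= 4 ^ (2 ^ j)
  & forall k, 0 < k <= 2 ^ j -> k %| Q].
Proof.
elim: j => [|j [Q [Q0 QK Qk]]].
  by exists 1; split => // k; rewrite expn0 -eqn_leq => /eqP <-.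
set n := 2 ^ j in QK Qk; have n0 : 0 < n by rewrite expn_gt0.
have C0 : 0 < 'C(2 * n, n) by rewrite bin_gt0; lia.
exists (Q * 'C(2 * n, n)); rewrite expnS -/n; split.
- by rewrite muln_gt0 Q0.
- rewrite mulSn mul1n expnD leq_mul // (leq_trans (bin_le_exp2 _ _)) //.
  by rewrite addnn -mul2n expnM.
move=> k /andP[k0 k2n].
apply/(dvdn_partP _ k0) => p; rewrite mem_primes => /and3P[pp _ pk].
rewrite p_part; set e := logn p k.
have e0 : 0 < e by rewrite logn_gt0 mem_primes pp k0.
have pek : p ^ e %| k by apply: pfactor_dvdnn.
have pe2n : p ^ e <= 2 * n by apply: leq_trans (dvdn_leq k0 pek) k2n.
have [pen|npe] := leqP (p ^ e) n.
  by apply/dvdn_mulr/Qk; rewrite pen expn_gt0 prime_gt0.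
(* Here [n < p ^ e <= 2n]: the power [p ^ e.-1] is at most [n], hence divides [Q], and the missing
   factor [p] divides the binomial coefficient. *)
rewrite -(prednK e0) expnSr; apply: dvdn_mul.
  apply: Qk; rewrite expn_gt0 prime_gt0 //=.
  rewrite -(@leq_pmul2l 2) // (leq_trans _ pe2n) // -{2}(prednK e0) expnS.
  by rewrite leq_mul2r prime_gt1 // orbT.
by apply: (@prime_dvd_central_bin _ _ e); rewrite ?npe.
Qed.

End PrimeFactors.

(** * Roots of families of linear forms modulo a prime *)

Section Roots.

Local Open Scope nat_scope.

Lemma dvdn_prod_forms p L n : prime p ->
  (p %| \prod_(f <- L) form_eval f n) = has (fun f => p %| form_eval f n) L.
Proof.
move=> pp; rewrite (Euclid_dvd_prod _ _ _ pp).
exact: big_has.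
Qed.

Lemma dvdn_form_eval_mod p f n :
  (p %| form_eval f (n %% p)) = (p %| form_eval f n).
Proof. by rewrite /form_eval /dvdn -modnDml modnMmr modnDml. Qed.

Lemma nroots_lt L p m : prime p -> all (fun f => ~~ (p %| form_eval f m)) L ->
  nroots L p < p.
Proof.
move=> pp /allP Lm; rewrite /nroots.
set A := [pred n : 'I_p | _].
have := cardC A; rewrite card_ord => E.
have mp : m %% p < p by rewrite ltn_pmod ?prime_gt0.
suff : 0 < #|[predC A]|.
  by move=> C0; rewrite -[X in _ < X]E -[X in X < _]addn0 ltn_add2l.
apply/card_gt0P; exists (Ordinal mp); rewrite !inE /= dvdn_prod_forms //.
by apply/hasPn => f fL; rewrite dvdn_form_eval_mod; apply: Lm.
Qed.

Lemma admissible_nonroot L f p : admissible L -> f \in L -> prime p ->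
  exists n, ~~ (p %| form_eval f n).
Proof.
move=> adm fL pp; apply: contrapT => nex.
have := adm p pp; rewrite /nroots.
set A := [pred n : 'I_p | _].
suff -> : #|A| = p by rewrite ltnn.
rewrite -[RHS]card_ord; apply: eq_card => n; rewrite !inE /= dvdn_prod_forms //.
apply/hasP; exists f => //; apply: contrapT => /negP H.
by apply: nex; exists n.
Qed.

(** Two roots [x], [y] give [p %| f.1 * (y - x)]. If [p] divided [f.1], the form would be constant
    modulo [p], and a root would contradict the nonroot [n]. *)
Lemma form_roots_le1 f p n : prime p -> ~~ (p %| form_eval f n) ->
  #|[pred x : 'I_p | p %| form_eval f x]| <= 1.
Proof.
move=> pp nf.
suff H (x y : 'I_p) : x <= y -> p %| form_eval f x -> p %| form_eval f y -> x = y.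
  apply/card_le1_eqP => x y; rewrite !inE => fx fy.
  have [yx|/ltnW xy] := leqP y x; first exact: H yx fy fx.
  by apply/esym; exact: H xy fx fy.
rewrite /form_eval => xy fx fy.
have : p %| f.1 * (y - x).
  by rewrite mulnBr -(subnDr f.2) dvdn_sub.
rewrite Euclid_dvdM // => /orP[pf1|pyx].
  case/negP: nf; move: fx; rewrite /form_eval.
  by rewrite !dvdn_addr // dvdn_mulr.
apply/val_inj/eqP; rewrite /= eqn_leq xy /= -subn_eq0.
by rewrite -(modn_small (leq_ltn_trans (leq_subr x y) (ltn_ord y))).
Qed.

Lemma nroots_le_size L p : prime p -> admissible L -> nroots L p <= size L.
Proof.
move=> pp adm.
have nr f : f \in L -> exists n, ~~ (p %| form_eval f n).
  by move=> fL; apply: (@admissible_nonroot L).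
suff : #|[pred n : 'I_p | has (fun f => p %| form_eval f n) L]| <= size L.
  apply: leq_trans; rewrite eq_leq //.
  by apply: eq_card => n; rewrite !inE dvdn_prod_forms.
elim: L nr {adm} => [|f L IH] nr.
  by rewrite leqn0; apply/eqP/eq_card0 => n; rewrite !inE.
have [n nf] := nr f (mem_head _ _).
have := form_roots_le1 _ _ _ pp nf.
have /IH : forall g, g \in L -> exists n, ~~ (p %| form_eval g n).
  by move=> g gL; apply: nr; rewrite inE gL orbT.
rewrite /= => h1 h2.
rewrite (eq_card (B := [predU [pred x : 'I_p | p %| form_eval f x] &
  [pred n : 'I_p | has (fun f => p %| form_eval f n) L]])); last first.
  by move=> x; rewrite !inE.
by rewrite -add1n; apply: leq_trans (leq_add h2 h1); rewrite -cardUI leq_addr.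
Qed.

Lemma linear_root p a b : prime p -> ~~ (p %| a) ->
  exists n, p %| a * n + b.
Proof.
move=> pp pa; have cap : coprime a p by rewrite coprime_sym prime_coprime.
(* A multiple of [a] congruent to [-b] modulo [p], with [-b] written as [p.-1 * b]. *)
set x := chinese a p 0 (p.-1 * b).
have ax : a %| x by rewrite /dvdn chinese_modl // mod0n.
exists (x %/ a); rewrite mulnC divnK // /dvdn -modnDml chinese_modr //.
by rewrite modnDml -mulSnr prednK ?prime_gt0 // modnMr.
Qed.

Lemma admissible_coprime L f : admissible L -> f \in L -> coprime f.1 f.2.
Proof.
move=> adm fL; rewrite /coprime; apply: contraT => g1.
set g := gcdn f.1 f.2 in g1.
have [p pp /andP[p1 p2]] : exists2 p, prime p & (p %| f.1) && (p %| f.2).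
  have [g0|g0] := posnP g.
    exists 2 => //; have := dvdn_gcd 0 f.1 f.2.
    rewrite -/g g0 dvd0n eqxx => /esym /andP[].
    by rewrite !dvd0n => /eqP -> /eqP ->.
  have /pdivP[p pp pg] : 1 < g by rewrite ltn_neqAle eq_sym g1.
  by exists p => //; rewrite -dvdn_gcd.
have [n] := @admissible_nonroot L f p adm fL pp.
by rewrite /form_eval dvdn_addr ?dvdn_mulr // p2.
Qed.

(* For large p the coprimality of the coefficients keeps the K roots distinct. *)
Lemma size_le_nroots L : form_set L -> admissible L ->
  exists B, forall p, prime p -> B < p -> size L <= nroots L p.
Proof.
move=> [uL posL] adm.
set s := \max_(f <- L) (f.1 + f.2).
have s1 f : f \in L -> f.1 + f.2 <= s.
  by move=> fL; apply: (@leq_bigmax_seq _ L xpredT (fun f => f.1 + f.2)).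
(* Both cross products [g.1 * f.2] and [f.1 * g.2] are at most [s * s], so their congruence modulo
   [p], forced by a shared root, is an equality. *)
exists (s * s) => p pp sp.
have exr (f : linform) : exists x : 'I_p, f \in L -> p %| form_eval f x.
  have p0 : 0 < p by rewrite prime_gt0.
  have [fL|fL] := boolP (f \in L); last by exists (Ordinal p0).
  have [f10 f20] := posL f fL.
  have nf : ~~ (p %| f.1).
    apply/negP => /(dvdn_leq f10) => H.
    by have := s1 f fL; nia.
  have [n Hn] := @linear_root p f.1 f.2 pp nf.
  have np : n %% p < p by rewrite ltn_pmod.
  by exists (Ordinal np) => _; rewrite /= dvdn_form_eval_mod.
have [r Hr] := choice exr.
have inj : {in L &, injective r}.
  move=> f g fL gL rfg.
  have [f10 f20] := posL f fL; have [g10 g20] := posL g gL.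
  have := Hr f fL; have := Hr g gL; rewrite -rfg /form_eval.
  set x := nat_of_ord (r f) => gx fx.
  have E : g.1 * f.2 = f.1 * g.2.
    have bound a b c d : a + b <= s -> c + d <= s -> a * d < p.
      by move=> *; apply: leq_ltn_trans sp; apply: leq_mul; lia.
    rewrite -(modn_small (bound _ _ _ _ (s1 g gL) (s1 f fL))).
    rewrite -(modn_small (bound _ _ _ _ (s1 f fL) (s1 g gL))).
    apply/eqP; rewrite -(eqn_modDl (f.1 * (g.1 * x))).
    rewrite -mulnDr {1}mulnCA -mulnDr.
    by rewrite (eqP (dvdn_mull f.1 gx)) (eqP (dvdn_mull g.1 fx)).
  have cf := admissible_coprime _ _ adm fL; have cg := admissible_coprime _ _ adm gL.
  have E1 : f.1 = g.1.
    apply/eqP; rewrite eqn_dvd -(Gauss_dvdl g.1 cf) E dvdn_mulr //=.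
    by rewrite -(Gauss_dvdl f.1 cg) -E dvdn_mulr.
  move: E; rewrite E1 => /eqP; rewrite eqn_pmul2l // => /eqP E2.
  by move: E1 E2; case: (f) => a b; case: (g) => c d /= -> ->.
rewrite /nroots cardE -(size_map r); apply: uniq_leq_size.
  by rewrite map_inj_in_uniq.
move=> _ /mapP[f fL ->]; rewrite mem_enum inE /= dvdn_prod_forms //.
by apply/hasP; exists f => //; apply: Hr.
Qed.

End Roots.

(** * Convergence of the singular series and an explicit lower bound *)

Section SingularSeries.

Variable R : realType.

Lemma bernoulli_exp (z : R) n : -1 <= z -> 1 + n%:R * z <= (1 + z) ^+ n.
Proof.
move=> z1; elim: n => [|n IH]; first by rewrite mul0r addr0 expr0.
rewrite exprS; have z0 : 0 <= 1 + z by lra.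
apply: le_trans (ler_wpM2l z0 IH).
rewrite -natr1; have := sqr_ge0 z; have := ler0n R n; nra.
Qed.

Definition local_factor (w K p : nat) : R :=
  (1 - w%:R / p%:R) * (1 - p%:R^-1) ^- K.

Lemma local_factor_ge_inv w K p : (1 < p)%N -> (w < p)%N ->
  p%:R^-1 <= local_factor w K p.
Proof.
move=> p1 wp; rewrite /local_factor.
have p0 : 0 < p%:R :> R by rewrite ltr0n; lia.
have pi0 : 0 < (p%:R^-1 : R) by rewrite invr_gt0.
have pi1 : (p%:R^-1 : R) < 1 by rewrite invf_lt1 // ltr1n.
have h1 : p%:R^-1 <= 1 - w%:R / p%:R :> R.
  rewrite -(@ler_pM2r _ p%:R) // mulrBl mul1r mulVf ?gt_eqF // divfK ?gt_eqF //.
  by rewrite lerBrDr nat1r ler_nat.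
apply: (le_trans h1); rewrite ler_peMr ?(le_trans (ltW pi0)) //.
rewrite invf_ge1 ?exprn_gt0 ?subr_gt0 //.
by rewrite exprn_ile1 // ?lerBlDr ?lerDl ?subr_ge0 // ltW.
Qed.

(** Bernoulli gives [(1 - 1/p)^(-K) >= 1 + K/p]; multiplied by [1 - K/p], the first-order terms
    cancel. *)
Lemma local_factor_ge w K p : (1 < p)%N -> (w <= K <= p)%N ->
  1 - (K%:R / p%:R) ^+ 2 <= local_factor w K p.
Proof.
move=> p1 /andP[wK Kp]; rewrite /local_factor.
have p0 : 0 < p%:R :> R by rewrite ltr0n; lia.
set z := (p%:R^-1 : R).
have z0 : 0 < z by rewrite invr_gt0.
have z1 : z < 1 by rewrite invf_lt1 // ltr1n.
have h1 : 1 - K%:R * z <= 1 - w%:R * z.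
  by rewrite lerB // ler_wpM2r ?ler_nat // ltW.
have h2 : 1 + K%:R * z <= (1 - z) ^- K.
  apply: (le_trans (bernoulli_exp z K _)); first by lra.
  rewrite -[leRHS]mul1r ler_pdivlMr ?exprn_gt0 ?subr_gt0 // -exprMn.
  by apply: exprn_ile1; nra.
have h3 : 0 <= 1 - K%:R * z.
  by rewrite subr_ge0 ler_pdivrMr // mul1r ler_nat.
have h4 : 0 <= 1 + K%:R * z by rewrite addr_ge0 // mulr_ge0 // ltW.
apply: le_trans (ler_pM h3 h4 h1 h2); rewrite le_eqVlt; apply/orP; left.
by apply/eqP; ring.
Qed.

(** Bernoulli gives [(1 - 1/p)^K >= 1 - K/p]. This makes the partial products eventually
    nonincreasing. *)
Lemma local_factor_le1 w K p : (1 < p)%N -> (K <= w)%N -> (w < p)%N ->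
  local_factor w K p <= 1.
Proof.
move=> p1 Kw wp; rewrite /local_factor.
have p0 : 0 < p%:R :> R by rewrite ltr0n; lia.
set z := (p%:R^-1 : R).
have z0 : 0 < z by rewrite invr_gt0.
have z1 : z < 1 by rewrite invf_lt1 // ltr1n.
rewrite ler_pdivrMr ?exprn_gt0 ?subr_gt0 // mul1r.
apply: le_trans (bernoulli_exp (- z) K _); last by lra.
by rewrite mulrN lerB // ler_wpM2r ?ler_nat // ltW.
Qed.

Variable L : seq linform.
Hypothesis Lform : form_set L.
Hypothesis Lpos : (0 < size L)%N.
Hypothesis Ladm : admissible L.

Let K := size L.

Let u (N : nat) : R := \prod_(0 <= p < N | prime p) local_factor (nroots L p) K p.

Let g p : R := if prime p then local_factor (nroots L p) K p else 1.

Lemma partial_productS N : u N.+1 = u N * g N.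
Proof. by rewrite /u big_mkcond big_nat_recr //= -big_mkcond. Qed.

Lemma partial_product_ge N : (N`!%:R)^-1 <= u N.+1.
Proof.
elim: N => [|N IH].
  by rewrite fact0 invr1 partial_productS /u big_geq // mul1r /g.
rewrite partial_productS factS natrM invfM [leLHS]mulrC.
have f0 : 0 <= (N`!%:R^-1 : R) by rewrite invr_ge0 ler0n.
apply: ler_pM => //; rewrite ?invr_ge0 ?ler0n //.
rewrite /g; case: ifP => pN; last by rewrite invf_le1 ?ler1n ?ltr0n.
by apply: local_factor_ge_inv; [apply: prime_gt1|apply: Ladm].
Qed.

(* The factor at p > K is at least 1 - (K/p)^2, and sum_(p > M) 1/p^2 <= 1/M. *)
Lemma partial_product_tail_ge M N : (K <= M)%N -> (2 * K ^ 2 <= M)%N -> (M <= N)%N ->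
  (M`!%:R)^-1 * (1 - K%:R ^+ 2 * (M%:R^-1 - N%:R^-1)) <= u N.+1.
Proof.
move=> KM K2M MN; rewrite -(subnKC MN); elim: (N - M)%N => [|d IH].
  by rewrite addn0 subrr mulr0 subr0 mulr1; apply: partial_product_ge.
rewrite addnS partial_productS; set n := (M + d)%N in IH *.
have M0 : (0 < M)%N by lia.
have n0 : (0 < n)%N by lia.
have f0 : 0 < (M`!%:R^-1 : R) by rewrite invr_gt0 ltr0n fact_gt0.
have nR : 0 < n%:R :> R by rewrite ltr0n.
have n1R : 0 < n.+1%:R :> R by rewrite ltr0n.
have MR : 0 < M%:R :> R by rewrite ltr0n.
have Mn : n%:R^-1 <= M%:R^-1 :> R by rewrite lef_pV2 ?posrE // ler_nat leq_addr.
set A := K%:R ^+ 2 * (M%:R^-1 - n%:R^-1) in IH *.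
have A0 : 0 <= A by rewrite mulr_ge0 ?sqr_ge0 ?subr_ge0.
have A1 : A <= 1.
  apply: (@le_trans _ _ (K%:R ^+ 2 / M%:R)).
    by rewrite ler_wpM2l ?sqr_ge0 // lerBlDr lerDl invr_ge0 ltW.
  by rewrite ler_pdivrMr // mul1r -natrX ler_nat; lia.
set B := (K%:R / n.+1%:R) ^+ 2 : R.
have B0 : 0 <= B by apply: sqr_ge0.
have gB : 1 - B <= g n.+1.
  rewrite /g; case: ifP => pn; last by rewrite lerBlDr lerDl.
  by apply: local_factor_ge; rewrite ?nroots_le_size ?prime_gt1 //= (leq_trans KM) // leqW ?leq_addr.
have tele : K%:R ^+ 2 * (M%:R^-1 - n.+1%:R^-1) >= A + B.
  rewrite /A /B expr_div_n -mulrDr ler_wpM2l ?sqr_ge0 //.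
  suff : n.+1%:R ^- 2 <= n%:R^-1 - n.+1%:R^-1 :> R.
    by move=> H; rewrite -addrA lerD2l addrC -lerBrDr opprK addrC.
  have -> : n%:R^-1 - n.+1%:R^-1 = (n%:R * n.+1%:R)^-1 :> R.
    by rewrite -natr1; field; rewrite natr1 !gt_eqF.
  by rewrite lef_pV2 ?posrE ?exprn_gt0 ?mulr_gt0 // expr2 ler_pM2r // ler_nat.
have B1 : B <= 1.
  rewrite /B expr_le1 // ?divr_ge0 ?ler0n //.
  by rewrite ler_pdivrMr // mul1r ler_nat (leq_trans KM) // leqW ?leq_addr.
apply: (@le_trans _ _ (M`!%:R^-1 * (1 - A) * (1 - B))).
  have H (a b c : R) : 0 <= a -> 0 <= b -> a + b <= c -> 1 - c <= (1 - a) * (1 - b).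
    by move=> a0 b0 abc; nra.
  by rewrite -mulrA ler_pM2l //; apply: H.
apply: ler_pM => //; first by rewrite mulr_ge0 ?(ltW f0) ?subr_ge0.
by rewrite subr_ge0.
Qed.

(** The factors up to [M = 2 K^2] contribute at least [1 / M!], and beyond [M] the telescoped loss
    is at most [K^2 / M = 1/2]. *)
Lemma singular_series_ge : ((2 * (2 * K ^ 2)`!)%:R)^-1 <= singular_series R L.
Proof.
set M := (2 * K ^ 2)%N; have K0 : (0 < K)%N := Lpos.
have M0 : (0 < M)%N by rewrite muln_gt0 expn_gt0 K0.
have uM N : (M < N)%N -> ((2 * M`!)%:R)^-1 <= u N.
  case: N => // N; rewrite ltnS => MN.
  have KM : (K <= M)%N by rewrite /M; nia.
  apply: le_trans (partial_product_tail_ge _ _ KM (leqnn _) MN).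
  rewrite natrM invfM mulrC ler_pM2l ?invr_gt0 ?ltr0n ?fact_gt0 //.
  rewrite lerBrDr -lerBrDl.
  apply: (@le_trans _ _ (K%:R ^+ 2 / M%:R)).
    by rewrite ler_wpM2l ?sqr_ge0 // lerBlDr lerDl invr_ge0 ler0n.
  rewrite /M natrM -natrX invfM mulrCA mulfV ?mulr1; first by lra.
  by rewrite pnatr_eq0 -lt0n expn_gt0 K0.
have near_uM : \forall N \near \oo, ((2 * M`!)%:R)^-1 <= u N.
  by exists M.+1 => // N; apply: uM.
have [B HB] := size_le_nroots _ Lform Ladm.
(* Bounding the limit requires convergence, which follows from the lower bound and monotonicity past
   [B] and [M]. *)
apply: limr_ge (near_uM); apply: near_nonincreasing_is_cvgn (near_uM).
exists (maxn B M).+1 => // N /= BN N'.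
elim: N' => [|N' IH]; first by rewrite leqn0 => /eqP ->.
rewrite leq_eqVlt => /orP[/eqP <-//|]; rewrite ltnS => NN'.
apply: le_trans (IH NN').
have uN' : 0 <= u N'.
  by apply: le_trans (uM N' _); [rewrite invr_ge0 ler0n|lia].
rewrite partial_productS ler_piMr // /g; case: ifP => // pN.
by apply: local_factor_le1; [apply: prime_gt1|apply: HB => //; lia|apply: Ladm].
Qed.

End SingularSeries.

(** * The admissible family of forms attached to [Q], [P] and [k0] *)

Section TupleForms.

Local Open Scope nat_scope.

(* With n = Q (P m + k0), the form of index k is (n + k) / k, and for k = k0 it
   is (n + k0) / (k0 P). *)
Definition tuple_form (Q P k0 k : nat) : linform :=
  if k == k0 then (Q %/ k0, Q.+1 %/ P) else (Q %/ k * P, Q %/ k * k0 + 1).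

Variables Q P k0 K : nat.
Hypothesis Q_gt0 : 0 < Q.
Hypothesis Q_mult : forall k, 0 < k <= K -> k %| Q.
Hypothesis P_prime : prime P.
Hypothesis P_dvd : P %| Q.+1.
Hypothesis k0_le : 0 < k0 <= K.

Definition tuple_forms := [seq tuple_form Q P k0 k | k <- iota 1 K].

Lemma P_ndvd_Q : ~~ (P %| Q).
Proof.
by apply/negP => PQ; move: P_dvd; rewrite -addn1 dvdn_addr // Euclid_dvd1.
Qed.

Lemma K_lt_P : K < P.
Proof.
rewrite ltnNge; apply/negP => PK; move: P_ndvd_Q.
by rewrite Q_mult // prime_gt0.
Qed.

(** For [k = k0] the constant term is [Q k0 + k0 = k0 (Q + 1)], where [P %| Q.+1] supplies the extra
    factor [P]. *)
Lemma tuple_form_eval k m : 0 < k <= K ->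
  k * (if k == k0 then P else 1) * form_eval (tuple_form Q P k0 k) m
  = Q * (P * m + k0) + k.
Proof.
move=> kK; have := divnK (Q_mult k kK); rewrite /tuple_form /form_eval.
case: eqP => [->|_] /= E; last by rewrite -{3}E; ring.
have E2 := divnK P_dvd.
transitivity (P * (Q %/ k0 * k0) * m + k0 * (Q.+1 %/ P * P)); first by ring.
by rewrite E E2 mulnS; ring.
Qed.

(** The leading coefficients separate the forms: [P] divides all but that of index [k0], and
    [Q %/ k] determines [k]. *)
Lemma tuple_form_inj : {in [pred k | 0 < k <= K] &, injective (tuple_form Q P k0)}.
Proof.
have P0 := prime_gt0 P_prime.
have mixed k : 0 < k <= K -> k != k0 ->
    tuple_form Q P k0 k = tuple_form Q P k0 k0 -> False.
  move=> kK /negPf kk0; rewrite /tuple_form kk0 eqxx => -[E _].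
  have : P %| Q %/ k0 by rewrite -E dvdn_mull.
  move=> /(dvdn_mulr k0); rewrite divnK ?(Q_mult k0) //.
  by apply/negP/P_ndvd_Q.
move=> a b aK bK E; rewrite !inE in aK bK.
have [ak|ak] := eqVneq a k0; have [bk|bk] := eqVneq b k0.
- by rewrite ak bk.
- by case: (mixed b bK bk); rewrite -E ak.
- by case: (mixed a aK ak); rewrite E bk.
move: E; rewrite /tuple_form (negPf ak) (negPf bk) => -[+ _].
move=> /eqP; rewrite eqn_pmul2r // => /eqP E.
have /eqP : Q %/ b * a = Q %/ b * b by rewrite -{1}E !divnK ?Q_mult.
rewrite eqn_pmul2l; first by move=> /eqP.
by rewrite divn_gt0; [apply: dvdn_leq (Q_mult b bK)|case/andP: bK].
Qed.

Lemma mem_tuple_forms f : f \in tuple_forms ->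
  exists2 k, 0 < k <= K & f = tuple_form Q P k0 k.
Proof. by case/mapP => k; rewrite mem_iota add1n ltnS => kK ->; exists k. Qed.

Lemma tuple_form_gt0 k : 0 < k <= K ->
  0 < (tuple_form Q P k0 k).1 /\ 0 < (tuple_form Q P k0 k).2.
Proof.
move=> kK; rewrite /tuple_form; case: eqP => _ /=.
  rewrite !divn_gt0 ?(prime_gt0 P_prime) ?(dvdn_leq _ P_dvd) //.
    by rewrite dvdn_leq ?Q_mult.
  by case/andP: k0_le.
rewrite muln_gt0 (prime_gt0 P_prime) addn1 andbT; split=> //.
by rewrite divn_gt0; [apply: dvdn_leq (Q_mult k kK)|case/andP: kK].
Qed.

Lemma form_set_tuple_forms : form_set tuple_forms.
Proof.
split; last by move=> f /mem_tuple_forms[k kK ->]; apply: tuple_form_gt0.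
rewrite map_inj_in_uniq ?iota_uniq // => a b.
by rewrite !mem_iota !add1n !ltnS; apply: tuple_form_inj.
Qed.

Lemma tuple_forms_le f : f \in tuple_forms ->
  f.1 <= Q.+1 ^ 2 /\ f.2 <= Q.+1 ^ 2.
Proof.
have PQ : P <= Q.+1 by apply: dvdn_leq P_dvd.
have kQ : k0 <= Q by apply: dvdn_leq (Q_mult k0 k0_le).
case/mem_tuple_forms => k kK ->; rewrite /tuple_form.
have q1 := leq_div Q k; have q2 := leq_div Q k0; have q3 := leq_div Q.+1 P.
by case: ifP => _ /=; split; nia.
Qed.

(* Modulo p <> P choose m with p | P m + k0, so that every form is 1 up to a
   unit; modulo P only the form of index k0 can vanish. *)
Lemma admissible_tuple_forms : admissible tuple_forms.
Proof.
move=> p pp; have [->{p pp}|pP] := eqVneq p P.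
  have [m Hm] : exists m, ~~ (P %| form_eval (tuple_form Q P k0 k0) m).
    rewrite /tuple_form eqxx /form_eval /=.
    have [H|H] := boolP (P %| Q.+1 %/ P); last by exists 0; rewrite muln0 add0n.
    exists 1; rewrite muln1 dvdn_addl //.
    apply: contra P_ndvd_Q => /(dvdn_mulr k0).
    by rewrite divnK // Q_mult.
  apply: (@nroots_lt _ _ m) => //; apply/allP => f /mem_tuple_forms[k kK ->].
  have [->//|kk0] := eqVneq k k0.
  apply/negP => /(dvdn_mull (k * (if k == k0 then P else 1))).
  rewrite tuple_form_eval // => H.
  (* This sum is [n + k0]. If [P] also divided [n + k], it would divide the nonzero difference of
     [k] and [k0], which is smaller than [P]. *)
  have : P %| Q.+1 * k0 + Q * P * m by apply: dvdn_add; [apply: dvdn_mulr|apply/dvdn_mulr/dvdn_mull].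
  have -> : Q.+1 * k0 + Q * P * m = Q * (P * m + k0) + k0 by rewrite mulSn; ring.
  move=> H0; have KP := K_lt_P; case/andP: kK k0_le => k1 kK /andP[k01 k0K].
  have [lt|le] := ltnP k k0.
    have := dvdn_sub H0 H; rewrite subnDl => /dvdn_leq; rewrite subn_gt0 => /(_ lt).
    by rewrite leqNgt (leq_ltn_trans (leq_subr _ _)) // (leq_ltn_trans k0K).
  have {}le : k0 < k by rewrite ltn_neqAle eq_sym kk0.
  have := dvdn_sub H H0; rewrite subnDl => /dvdn_leq; rewrite subn_gt0 => /(_ le).
  by rewrite leqNgt (leq_ltn_trans (leq_subr _ _)) // (leq_ltn_trans kK).
have nP : ~~ (p %| P) by rewrite dvdn_prime2.
have [m Hm] := linear_root _ _ k0 pp nP.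
apply: (@nroots_lt _ _ m) => //; apply/allP => f /mem_tuple_forms[k kK ->].
have : ~~ (p %| Q %/ k * (P * m + k0) + 1).
  by rewrite dvdn_addr ?dvdn_mull // Euclid_dvd1.
apply: contra => /(dvdn_mull (if k == k0 then P else 1)).
have k_gt0 : 0 < k by case/andP: kK.
suff -> : (if k == k0 then P else 1) * form_eval (tuple_form Q P k0 k) m
  = Q %/ k * (P * m + k0) + 1 by [].
apply/eqP; rewrite -(eqn_pmul2l k_gt0) mulnA tuple_form_eval //.
by rewrite -{1}(divnK (Q_mult k kK)); apply/eqP; ring.
Qed.

(** The prime values are at least [m > P > K], so each is new to [k] and to [P]; likewise [P] is new
    to [k0], which yields the extra 1. *)
Lemma omega_tuple m : P < m ->
  all (fun f => prime (form_eval f m)) tuple_forms ->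
  forall k, 0 < k <= K -> omega (Q * (P * m + k0) + k) = omega k + 1 + (k == k0).
Proof.
move=> Pm /allP all_p k kK; rewrite -tuple_form_eval //.
have KP := K_lt_P; have P0 := prime_gt0 P_prime.
have /andP[k_gt0 k_le] := kK.
set q := form_eval _ m.
have pq : prime q.
  by apply: all_p; apply: map_f; rewrite mem_iota add1n ltnS.
have mq : m <= q.
  have [t1 _] := tuple_form_gt0 k kK.
  by rewrite /q /form_eval; nia.
have qk : ~~ (q %| k) by rewrite gtnNdvd //; lia.
case: eqP => [E|_]; last by rewrite muln1 omega_mul_prime // addn0 addn1.
have Pk : ~~ (P %| k) by rewrite gtnNdvd //; lia.
rewrite omega_mul_prime ?muln_gt0 ?k_gt0 //; last first.
  by rewrite Euclid_dvdM // negb_or qk gtnNdvd //; lia.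
by rewrite omega_mul_prime // !addn1.
Qed.

End TupleForms.

(** * Numerical inequalities for the parameters with [K = 2 * i] *)

Section Growth.

Local Open Scope nat_scope.

Lemma quadratic_le_pow2 i : 10 <= i -> 8 * i ^ 2 <= 2 ^ i.
Proof.
move=> /subnK <-; elim: (i - 10) => [//|d]; rewrite addSn.
set n := d + 10; have n10 : 10 <= n by rewrite leq_addl.
by rewrite [2 ^ n.+1]expnS; move: (2 ^ n) => z; rewrite !expnS !expn0; nia.
Qed.

Lemma cubic_le_pow3 i : 10 <= i -> 8 * i ^ 3 <= 3 ^ i.
Proof.
move=> /subnK <-; elim: (i - 10) => [//|d]; rewrite addSn.
set n := d + 10; have n10 : 10 <= n by rewrite leq_addl.
rewrite [3 ^ n.+1]expnS; move: (3 ^ n) => z; rewrite !expnS !expn0 !muln1.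
move=> H; suff : n.+1 * (n.+1 * n.+1) <= 3 * (n * (n * n)) by lia.
by nia.
Qed.

(** The quadratic is chosen so that [(3/4)^i (i^2 + 5 i + 18)] never rises above its value 18 at 0:
    the induction step amounts to [i <= i^2]. *)
Lemma pow3_le_pow4 i : 3 ^ i * (i ^ 2 + 5 * i + 18) <= 18 * 4 ^ i.
Proof.
elim: i => [//|i IH]; rewrite [3 ^ _]expnS [4 ^ _]expnS.
move: IH; move: (3 ^ i) (4 ^ i) => a b IH.
suff : 3 * (i.+1 ^ 2 + 5 * i.+1 + 18) <= 4 * (i ^ 2 + 5 * i + 18).
  move=> H; have := leq_mul (leqnn a) H; move: (i.+1 ^ 2) (i ^ 2) IH => u v; nia.
by rewrite !expnS !expn0; nia.
Qed.

Lemma fact_le_exp n : n`! <= n ^ n.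
Proof.
rewrite -ffactnn ffact_prod -[X in _ ^ X]card_ord -prod_nat_const.
by apply: leq_prod => i _; apply: leq_subr.
Qed.

(** This is the factorial in the bound for the singular series. It is at most
    [(8 i^2)^(8 i^2) <= 2^(8 i^3)]. *)
Lemma fact_le_double_exp i : 10 <= i -> (2 * (2 * i) ^ 2)`! <= 2 ^ (3 ^ i).
Proof.
move=> i10; apply: leq_trans (fact_le_exp _) _.
have -> : 2 * (2 * i) ^ 2 = 8 * i ^ 2 by rewrite expnMn mulnA.
have h := quadratic_le_pow2 i i10.
apply: (@leq_trans ((2 ^ i) ^ (8 * i ^ 2))).
  by rewrite leq_exp2r // muln_gt0 expn_gt0 (leq_trans _ i10).
rewrite -expnM leq_exp2l //.
by apply: leq_trans (cubic_le_pow3 i i10); rewrite mulnCA -expnS.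
Qed.

(** With [K = 2 i] and [Y = 3^i (2 i + 6)] this reads [C (Y + K + 3) < 2^K]. The bracket is at most
    [3^i (4 i + 9)], and [162 = 18 * 9] keeps [18 C (4 i + 9)] below [i^2 + 5 i + 18]. *)
Lemma tail_bound C i : 2 <= i -> 162 * C < i ->
  C * (3 ^ i * (2 * i + 6) + 2 * i + 3) < 4 ^ i.
Proof.
move=> i2 Ci; rewrite -(@ltn_pmul2l 18) //.
apply: leq_trans (pow3_le_pow4 i).
have : 0 < 3 ^ i by rewrite expn_gt0.
move: (3 ^ i) => z z0.
have : 18 * (C * (4 * i + 9)) < i ^ 2 + 5 * i + 18 by rewrite expnS expn1; nia.
move: (i ^ 2) => s H; have := leq_mul (leqnn z) H.
by nia.
Qed.

End Growth.

(** * Counting lemmas and union bounds *)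

Section Counting.

Local Open Scope nat_scope.

Lemma count_has_le (T S : Type) (a : T -> S -> bool) (s : seq S) (r : seq T) :
  count (fun m => has (a m) s) r <= \sum_(k <- s) count (a^~ k) r.
Proof.
elim: s => [|k s IH]; first by rewrite big_nil count_pred0.
rewrite big_cons; apply: leq_trans (leq_add (leqnn _) IH).
by rewrite -count_predUI leq_addr.
Qed.

Lemma count_affine_le (a : pred nat) c d N Z : 0 < c -> c * N + d <= Z ->
  count (fun m => a (c * m + d)) (index_iota 1 N.+1)
    <= count a (index_iota 1 Z.+1).
Proof.
move=> c0 cZ; rewrite -(count_map (fun m => c * m + d) a) -!size_filter.
apply: uniq_leq_size.
  rewrite filter_uniq // map_inj_uniq ?iota_uniq // => x y /eqP.
  by rewrite eqn_add2r eqn_pmul2l // => /eqP.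
move=> v; rewrite !mem_filter => /andP[-> /mapP[m]] /=.
by rewrite !mem_index_iota => /andP[m0 mN] ->; nia.
Qed.

(** Union bound over the [M] shifts: for fixed [k] the map from [m] to [n + k] is injective into the
    integers from 1 to [2 ^ h]. *)
Lemma count_large_omega Q P k0 N M h Y : 0 < Q -> 0 < P ->
  Q * (P * N + k0) + M <= 2 ^ h ->
  count (fun m => has (fun k => Y < omega (Q * (P * m + k0) + k)) (iota 1 M))
    (index_iota 1 N.+1) * 2 ^ Y <= M * (2 ^ h * h.+1).
Proof.
move=> Q0 P0 Nh.
have H := count_has_le nat nat (fun m k => Y < omega (Q * (P * m + k0) + k)) (iota 1 M)
  (index_iota 1 N.+1).
apply: leq_trans (leq_mul H (leqnn (2 ^ Y))) _ => {H}.
rewrite big_distrl /= -[X in _ <= X * _](size_iota 1) -sum1_size big_distrl /=.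
rewrite big_seq [leqRHS]big_seq; apply: leq_sum => k.
rewrite mem_iota add1n ltnS mul1n => /andP[_ kM].
apply: leq_trans (count_omega_gt h Y); rewrite leq_mul2r; apply/orP; right.
have E m : Q * (P * m + k0) + k = Q * P * m + (Q * k0 + k) by ring.
rewrite (eq_count (a2 := fun m => Y < omega (Q * P * m + (Q * k0 + k)))); last first.
  by move=> m; rewrite /= E.
apply: (@count_affine_le (fun v => Y < omega v)); rewrite ?muln_gt0 ?Q0 //.
by rewrite -E; apply: leq_trans Nh; rewrite leq_add2l.
Qed.

Lemma count_lt_exists (T : eqType) (a b : pred T) s :
  count b s < count a s -> exists2 m, m \in s & a m && ~~ b m.
Proof.
move=> ba; apply: contrapT => nex; move: ba; rewrite ltnNge; case/negP.
rewrite (@eq_in_count _ _ (predI a b)); first by apply: sub_count => m /andP[].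
move=> m ms /=; case am: (a m) => //=; apply/esym; apply: contrapT => /negP nb.
by apply: nex; exists m; rewrite // am.
Qed.

Lemma count_le_index P N : count (fun m => m <= P) (index_iota 1 N) <= P.
Proof.
rewrite -[leqRHS](size_iota 1) -size_filter; apply: uniq_leq_size.
  by rewrite filter_uniq // iota_uniq.
by move=> m; rewrite mem_filter mem_index_iota mem_iota add1n ltnS => /and3P[-> ->].
Qed.

End Counting.

(** * Lower bound for the number of prime tuples *)

Section TupleCount.

Variable R : realType.

Lemma ln2_ge : 2^-1 <= ln 2 :> R.
Proof.
rewrite -[leLHS]expRK ler_ln ?posrE ?expR_gt0 //.
have := expR_ge1Dx (- 2^-1 : R); rewrite expRN => h.
have e0 := expR_gt0 (2^-1 : R).
rewrite -(@lef_pV2 _ _ _) ?posrE //; lra.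
Qed.

Lemma ln2_le : ln 2 <= 1 :> R.
Proof.
rewrite -[leRHS]expRK ler_ln ?posrE ?expR_gt0 //.
by have := expR_ge1Dx (1 : R); lra.
Qed.

(** The last two bounds verify the size conditions of the conjecture; the upper bound on [ln x]
    serves the main term. *)
Lemma iterated_ln_ge i : (2 <= i)%N -> let x := (2 ^ 2 ^ 3 ^ i)%:R : R in
  [/\ 0 < ln x, ln x <= (2 ^ 3 ^ i)%:R, (3 ^ i.-1)%:R <= ln (ln x)
    & i.-1%:R / 2 <= ln (ln (ln x))].
Proof.
move=> i2 x; have l1 := ln2_ge; have l2 := ln2_le.
have lx : ln x = (2 ^ 3 ^ i)%:R * ln 2 by rewrite /x natrX lnXn // mulr_natl.
have p0 : 0 < (2 ^ 3 ^ i)%:R :> R by rewrite ltr0n expn_gt0.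
have lx0 : 0 < ln x by rewrite lx mulr_gt0 //; lra.
have lx1 : ln x <= (2 ^ 3 ^ i)%:R by rewrite lx ler_piMr // ltW.
have lxge : (2 ^ (3 ^ i).-1)%:R <= ln x.
  rewrite lx -[in X in _ <= X](@prednK (3 ^ i)) ?expn_gt0 // expnS natrM.
  have : 0 <= (2 ^ (3 ^ i).-1)%:R :> R by rewrite ler0n.
  by move: (2 ^ _)%:R => z z0; nra.
have llx : (3 ^ i.-1)%:R <= ln (ln x).
  apply: (@le_trans _ _ (ln (2 ^ (3 ^ i).-1)%:R)); last first.
    by rewrite ler_ln ?posrE // ltr0n expn_gt0.
  rewrite (natrX _ 2) lnXn // -[leRHS]mulr_natl.
  have : (2 * 3 ^ i.-1 <= (3 ^ i).-1)%N.
    rewrite -{2}(@prednK i) ?(ltnW i2) // expnS.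
    by have : (0 < 3 ^ i.-1)%N; [rewrite expn_gt0|lia].
  rewrite -(ler_nat R) natrM.
  have : 0 <= (3 ^ i).-1%:R :> R by rewrite ler0n.
  by move: ((3 ^ i).-1%:R) => z; nra.
split => //.
apply: (@le_trans _ _ (ln (2 ^ i.-1)%:R)).
  by rewrite natrX lnXn // -[leRHS]mulr_natl ler_wpM2l.
have p3 : (2 ^ i.-1 <= 3 ^ i.-1)%N by rewrite leq_exp2r //; lia.
rewrite ler_ln ?posrE ?ltr0n ?expn_gt0 //.
  by apply: le_trans llx; rewrite ler_nat.
by apply: lt_le_trans llx; rewrite ltr0n expn_gt0.
Qed.

(** The exponent collects the losses: [3^i * 2 i] from the power of [ln x], [3^i + 1] from the
    singular series, and 1 from [1 + e >= 1/2]. *)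
Lemma tuple_count_ge : prime_tuples_conjecture R ->
  exists i0, forall i, (i0 <= i)%N -> forall L : seq linform,
    form_set L -> admissible L -> size L = (2 * i)%N ->
    (forall f, f \in L -> (f.1 <= 3 ^ (100 * i.-1))%N /\ (f.2 <= 3 ^ (100 * i.-1))%N) ->
    (2 ^ 2 ^ 3 ^ i <= count (fun m => all (fun f => prime (form_eval f m)) L)
        (index_iota 1 (2 ^ 2 ^ 3 ^ i).+1) * 2 ^ (3 ^ i * (2 * i).+1 + 2))%N.
Proof.
move=> [eps [eps0 conj]].
have e12 : \forall x \near +oo, `|eps x| < 2^-1.
  by move/cvgr0_norm_lt: eps0; apply.
have [X0 [X0r HX]] : \forall x \near +oo, `|eps x| < 2^-1 /\
    forall L : seq linform,
      form_set L -> (0 < size L)%N -> admissible L ->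
      (size L)%:R <= 100 * ln (ln (ln x)) ->
      (forall f, f \in L ->
        f.1%:R <= ln (ln x) ^+ 100 /\ f.2%:R <= ln (ln x) ^+ 100) ->
      exists e : R, `|e| <= eps x /\
        (prime_tuple_count L x)%:R =
          (1 + e) * singular_series R L * (x / ln x ^+ size L).
  by near=> x; split; near: x.
exists (maxn 10 (Num.truncn X0).+1) => i; rewrite geq_max => /andP[i10 iX] L.
move=> Lf La Ls Lb.
have i2 : (2 <= i)%N by lia.
have := iterated_ln_ge i i2; set N := (2 ^ 2 ^ 3 ^ i)%N; set x := N%:R => /= -[h1 h2 h3 h4].
have xX : X0 < x.
  apply: (lt_le_trans (truncnS_gt X0)); rewrite /x ler_nat (leq_trans iX) //.
  have t n : (n <= 2 ^ n)%N by apply/ltnW/ltn_expl.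
  have t3 n : (n <= 3 ^ n)%N by apply/ltnW/ltn_expl.
  by apply: leq_trans (t3 i) _; apply: leq_trans (t _) _; apply: t.
have [ex HL] := HX x xX.
have L0 : (0 < size L)%N by rewrite Ls; lia.
have [||e [e1 E]] := HL L Lf L0 La.
- rewrite Ls natrM; apply: (@le_trans _ _ (100 * (i.-1%:R / 2))); last first.
    by rewrite ler_wpM2l.
  have -> : i%:R = i.-1%:R + 1 :> R by rewrite natr1 prednK //; lia.
  have : 1 <= i.-1%:R :> R by rewrite ler1n; lia.
  by lra.
- move=> f /Lb [b1 b2].
  have H : (3 ^ (100 * i.-1))%:R <= ln (ln x) ^+ 100.
    rewrite mulnC expnM natrX; apply: lerXn2r; rewrite ?nnegrE ?ler0n //.
    by apply: le_trans h3; rewrite ler0n.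
  by split; apply: le_trans H; rewrite ler_nat.
have S := singular_series_ge R L Lf L0 La; rewrite Ls in S E.
move: E; rewrite /prime_tuple_count natrK.
set c := count _ _ => E.
rewrite -(ler_nat R) natrM -/x E.
have e2 : 2^-1 <= 1 + e.
  have : `|e| < 2^-1 by apply: le_lt_trans ex; apply: le_trans e1 (ler_norm _).
  by rewrite ltr_norml => /andP[]; lra.
have y0 : 0 < (2 ^ 3 ^ i)%:R :> R by rewrite ltr0n expn_gt0.
set y := (2 ^ 3 ^ i)%:R in y0 h2.
have S2 : (2 * y)^-1 <= singular_series R L.
  apply: le_trans S; rewrite lef_pV2 ?posrE ?mulr_gt0 ?ltr0n ?muln_gt0 ?fact_gt0 ?expn_gt0 //.
  by rewrite natrM ler_pM2l // ler_nat fact_le_double_exp.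
have x0 : 0 < x by rewrite ltr0n expn_gt0.
have l0 : 0 < ln x ^+ (2 * i) by rewrite exprn_gt0.
have lb : x / y ^+ (2 * i) <= x / ln x ^+ (2 * i).
  rewrite ler_pM2l // lef_pV2 ?posrE ?exprn_gt0 //.
  by apply: lerXn2r; rewrite ?nnegrE ?(ltW h1) ?(ltW y0).
have -> : (2 ^ (3 ^ i * (2 * i).+1 + 2))%:R = y ^+ (2 * i) * (2 * y) * 2 :> R.
  by rewrite expnD expnM natrM (natrX _ _ (2 * i).+1) -/y exprS; ring.
have yi0 : 0 < y ^+ (2 * i) by rewrite exprn_gt0.
have y20 : 0 < 2 * y by rewrite mulr_gt0.
apply: (@le_trans _ _ (2^-1 * (2 * y)^-1 * (x / y ^+ (2 * i)) * (y ^+ (2 * i) * (2 * y) * 2))).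
  rewrite le_eqVlt; apply/orP; left; apply/eqP; field.
  by rewrite !gt_eqF.
rewrite ler_pM2r ?mulr_gt0 //.
apply: ler_pM => //; first by rewrite mulr_ge0 ?invr_ge0 // ltW.
  by rewrite divr_ge0 ?ltW.
by apply: ler_pM => //; rewrite invr_ge0 // ltW.
Unshelve. all: by end_near. Qed.

End TupleCount.

(** * Choice of the shift [n] *)

Section GoodShift.

Local Open Scope nat_scope.

(** Put [y = 3^i] and [A = 2^y]. After multiplication by [2^(y (2 i + 6))], [P] and [bad] are each
    at most [2^(A + 3 y)], while [c] is at least [2^(A + 5 y - 2)]; the 5 is the excess of [2 i + 6]
    over [2 i + 1]. *)
Lemma exceptional_count_lt i P bad c : 10 <= i ->
  P <= 2 ^ (4 * i).+1 ->
  bad * 2 ^ (3 ^ i * (2 * i + 6)) <= (2 ^ 3 ^ i + 8 * i + 3) *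
    (2 ^ (2 ^ 3 ^ i + 8 * i + 3) * (2 ^ 3 ^ i + 8 * i + 3).+1) ->
  2 ^ 2 ^ 3 ^ i <= c * 2 ^ (3 ^ i * (2 * i).+1 + 2) ->
  P + bad < c.
Proof.
move=> i10 PB badB cB.
have i0 : 0 < i by lia.
have y8 : 8 * i + 80 <= 3 ^ i.
  apply: leq_trans (cubic_le_pow3 i i10); rewrite !expnS expn0; nia.
move: PB badB cB; set y := 3 ^ i in y8 *.
have y2 : 8 * y ^ 2 <= 2 ^ y by apply: quadratic_le_pow2; lia.
set A := 2 ^ y in y2 * => PB badB cB.
rewrite -(@ltn_pmul2r (2 ^ (y * (2 * i + 6)))) ?expn_gt0 // mulnDl.
have y_le : y <= y ^ 2 by rewrite expnS expn1 leq_pmulr //; lia.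
have yi_le : y * (2 * i + 6) <= y ^ 2 by rewrite expnS expn1 leq_mul2l; lia.
have P_le : P * 2 ^ (y * (2 * i + 6)) <= 2 ^ (A + 3 * y).
  apply: leq_trans (leq_mul PB (leqnn _)) _.
  rewrite -expnD leq_exp2l //.
  by move: (y ^ 2) (y * (2 * i + 6)) y2 y_le yi_le => s z; lia.
have A2 : A + 8 * i + 4 <= 2 ^ y.+1.
  by rewrite expnS -/A; move: (y ^ 2) y2 y_le => s; lia.
have bad_le : bad * 2 ^ (y * (2 * i + 6)) <= 2 ^ (A + 3 * y).
  apply: leq_trans badB _.
  apply: (@leq_trans (2 ^ y.+1 * (2 ^ (A + 8 * i + 3) * 2 ^ y.+1))).
    apply: leq_mul; last apply: leq_mul => //.
      by apply: leq_trans A2; rewrite leq_add2l.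
    by apply: leq_trans A2; rewrite -addnS.
  by rewrite -!expnD leq_exp2l //; clear -y8; lia.
have c_ge : 2 ^ (A + 5 * y - 2) <= c * 2 ^ (y * (2 * i + 6)).
  have -> : y * (2 * i + 6) = y * (2 * i).+1 + 2 + (5 * y - 2) by clear -y8; lia.
  have -> : A + 5 * y - 2 = A + (5 * y - 2) by clear -y8; lia.
  by rewrite (expnD 2 A) (expnD 2 (y * (2 * i).+1 + 2)) mulnA leq_mul2r cB orbT.
apply: leq_trans c_ge.
apply: leq_ltn_trans (leq_add P_le bad_le) _.
by rewrite addnn -mul2n -expnS ltn_exp2l //; clear -y8; lia.
Qed.

Lemma good_shift (R : realType) k0 C : prime_tuples_conjecture R -> 0 < k0 ->
  exists K Y n, [/\ k0 <= K, C * (Y + K + 3) < 2 ^ K,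
    forall k, 0 < k <= K -> omega (n + k) = omega k + 1 + (k == k0)
    & forall k, 0 < k -> omega (n + k) <= Y + k].
Proof.
move=> conj k00; have [i0 count_ge] := tuple_count_ge R conj.
have [j [i [Ei i_i0 i10 ik0 iC]]] : exists j i,
    [/\ 2 ^ j = 2 * i, i0 <= i, 10 <= i, k0 <= i & 162 * C < i].
  (* [K = 2 * i] is a power of two, as the common multiple requires, and [2^a > a] meets all lower
     bounds on [i] at once. *)
  exists (i0 + 10 + k0 + 162 * C).+1, (2 ^ (i0 + 10 + k0 + 162 * C)).
  rewrite expnS; have := ltn_expl (i0 + 10 + k0 + 162 * C) (ltnSn 1).
  by move: (2 ^ _) => z H; split => //; lia.
have [Q [Q0]] := small_common_multiple j.
rewrite Ei (expnM 4 2 i) -(expnM 2 4 i) => QK Qk.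
have pP : prime (pdiv Q.+1) by apply: pdiv_prime.
have PQ : pdiv Q.+1 %| Q.+1 by apply: pdiv_dvd.
have P_le : pdiv Q.+1 <= 2 ^ (4 * i).+1.
  apply: leq_trans (pdiv_leq (ltn0Sn Q)) _.
  by rewrite expnS; have : 0 < 2 ^ (4 * i); [rewrite expn_gt0|move: QK; lia].
move: (pdiv Q.+1) pP PQ P_le => P pP PQ P_le.
have k0K : 0 < k0 <= 2 * i by rewrite k00 /=; lia.
have Lf := form_set_tuple_forms _ _ _ _ Q0 Qk pP PQ k0K.
have La := admissible_tuple_forms _ _ _ _ Qk pP PQ k0K.
have Lb := tuple_forms_le _ _ _ _ Q0 Qk pP PQ k0K.
have Lw := omega_tuple _ _ _ _ Q0 Qk pP PQ k0K.
set L := tuple_forms Q P k0 (2 * i) in Lf La Lb Lw.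
have Ls : size L = 2 * i by rewrite size_map size_iota.
have coef f : f \in L -> f.1 <= 3 ^ (100 * i.-1) /\ f.2 <= 3 ^ (100 * i.-1).
  have Q3 : Q.+1 ^ 2 <= 3 ^ (100 * i.-1).
    apply: (@leq_trans ((2 ^ (5 * i)) ^ 2)).
      rewrite leq_exp2r //; apply: leq_ltn_trans QK _.
      by rewrite ltn_exp2l //; lia.
    rewrite -expnM; apply: (@leq_trans (2 ^ (100 * i.-1))).
      by rewrite leq_exp2l //; lia.
    by rewrite leq_exp2r //; lia.
  by move=> /Lb [b1 b2]; split; [apply: leq_trans b1 Q3|apply: leq_trans b2 Q3].
have := count_ge i i_i0 L Lf La Ls coef.
set N := 2 ^ 2 ^ 3 ^ i; set c := count _ _ => c_ge.
(* Exponent budget for [n]: [4 i] for [Q], [4 i + 1] for [P], [2 ^ 3 ^ i] for [N], and 1 for adding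
   [k0]. *)
set T := 2 ^ 3 ^ i + 8 * i + 2.
have N0 : 0 < N by rewrite expn_gt0.
have nT : Q * (P * N + k0) <= 2 ^ T.
  have k0Q : k0 <= Q by apply/dvdn_leq/Qk.
  have -> : T = 4 * i + ((4 * i).+1 + (1 + 2 ^ 3 ^ i)) by rewrite /T; lia.
  rewrite expnD; apply: leq_mul => //; rewrite expnD expnD -/N expn1.
  rewrite mul2n -addnn mulnDr; apply: leq_add; first by rewrite leq_mul2r P_le orbT.
  apply: leq_trans k0Q _; apply: leq_trans QK _.
  by apply: leq_trans (leq_pmulr _ N0); rewrite leq_exp2l.
set Y := 3 ^ i * (2 * i + 6).
have Nh : Q * (P * N + k0) + T.+1 <= 2 ^ T.+1.
  by rewrite expnS mul2n -addnn leq_add // ltn_expl.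
have bad_le := count_large_omega Q P k0 N T.+1 T.+1 Y Q0 (prime_gt0 pP) Nh.
set bad := count _ _ in bad_le.
have Tadd : T.+1 = 2 ^ 3 ^ i + 8 * i + 3 by rewrite /T -addnS.
rewrite Tadd in bad_le.
have lt_c := exceptional_count_lt i P bad c i10 P_le bad_le c_ge.
(* The [m <= P] are discarded too, since the exact values of [omega] require [m > P]. *)
have lt_c2 : count (predU (fun m => m <= P) (fun m => has
    (fun k => Y < omega (Q * (P * m + k0) + k)) (iota 1 T.+1))) (index_iota 1 N.+1) < c.
  apply: leq_ltn_trans lt_c.
  apply: leq_trans (leq_add (count_le_index P N.+1) (leqnn bad)).
  by rewrite -count_predUI leq_addr.
have [m mN /andP[m_prime]] := count_lt_exists _ _ _ _ lt_c2.
move=> /norP[mP /hasPn m_small].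
have Pm : P < m by rewrite ltnNge.
exists (2 * i), Y, (Q * (P * m + k0)); split.
- by case/andP: k0K.
- rewrite (expnM 2 2 i); apply: leq_ltn_trans (tail_bound C i _ iC); last by lia.
  by rewrite /Y.
- exact: Lw.
move=> k k_gt0; have [kT|Tk] := leqP k T.+1.
  have := m_small k; rewrite mem_iota add1n ltnS k_gt0 kT => /(_ isT).
  by rewrite /= -leqNgt => h; apply: leq_trans h (leq_addr _ _).
(* Beyond [T.+1] one has [n + k <= 2^k], so the logarithmic bound on [omega] suffices. *)
apply: (@leq_trans k); last by rewrite leq_addl.
apply: omega_le_log; rewrite -(ltn_predK Tk) expnS mul2n -addnn.
have mleN : m <= N by move: mN; rewrite mem_index_iota ltnS => /andP[].
apply: leq_add; last by rewrite (ltn_predK Tk) -{1}(ltn_predK Tk) ltn_expl.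
apply: leq_trans (leq_trans nT _).
  by rewrite leq_mul2l leq_add2r leq_mul2l mleN !orbT.
by rewrite leq_exp2l //; move: Tk; clear; lia.
Qed.

End GoodShift.

(** * Partial sums and tails of the series, and the final contradiction *)

Section Irrationality.

Variables (R : realType) (t : nat).
Hypothesis t_ge2 : (2 <= t)%N.

Let u (N : nat) : R := \sum_(1 <= n < N) ((omega n)%:R / t%:R ^+ n).

Let t_gt0 : 0 < t%:R :> R.
Proof. by rewrite ltr0n; apply: leq_trans t_ge2. Qed.

Let tX_gt0 n : 0 < t%:R ^+ n :> R.
Proof. by rewrite exprn_gt0. Qed.

Lemma omega_seriesS n : u n.+2 = u n.+1 + (omega n.+1)%:R / t%:R ^+ n.+1.
Proof. by rewrite /u big_nat_recr. Qed.

(** As [u N] stops at [N - 1], the partial sums of [T_n] are [t^n (u (n + k).+1 - u n.+1)]; this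
    adds the next term. *)
Lemma omega_series_shift n k : t%:R ^+ n * u (n + k).+2 =
  t%:R ^+ n * u (n + k).+1 + (omega (n + k.+1))%:R / t%:R ^+ k.+1.
Proof.
rewrite omega_seriesS mulrDr -addnS exprD invfM mulrCA mulVKf //.
by rewrite gt_eqF.
Qed.

(* The majorant telescopes: (Y+k+1)/2^(k+1) = (Y+k+2)/2^k - (Y+k+3)/2^(k+1). *)
Lemma omega_series_tail n Y K N :
  (forall k, (0 < k)%N -> (omega (n + k) <= Y + k)%N) -> (K <= N)%N ->
  t%:R ^+ n * u (n + N).+1 + (Y + N + 2)%:R / 2 ^+ N
    <= t%:R ^+ n * u (n + K).+1 + (Y + K + 2)%:R / 2 ^+ K.
Proof.
move=> HY /subnKC <-; elim: (N - K)%N => [|d IH]; first by rewrite addn0.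
apply: le_trans IH; rewrite addnS; set k := (K + d)%N.
rewrite addnS omega_series_shift -addrA lerD2l.
apply: (@le_trans _ _ ((Y + k.+1)%:R / 2 ^+ k.+1 + (Y + k.+1 + 2)%:R / 2 ^+ k.+1)).
  rewrite lerD2r; apply: ler_pM; rewrite ?invr_ge0 ?ler0n ?ler_nat ?HY //.
  rewrite lef_pV2 ?posrE ?exprn_gt0 //.
  by apply: lerXn2r; rewrite ?nnegrE ?ler0n ?ler_nat.
rewrite -mulrDl -natrD exprS invfM mulrA; apply: ler_wpM2r.
  by rewrite invr_ge0 exprn_ge0.
rewrite ler_pdivrMr // -natrM ler_nat; lia.
Qed.

Lemma omega_series_ndecr : nondecreasing_seq u.
Proof.
apply/nondecreasing_seqP => -[|n]; first by rewrite /u !big_geq.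
by rewrite omega_seriesS lerDl divr_ge0 ?ler0n // ltW.
Qed.

Lemma omega_series_cvg : cvgn u.
Proof.
apply: nondecreasing_is_cvgn; first exact: omega_series_ndecr.
exists 2 => _ [N _ <-].
apply: (@le_trans _ _ (u N.+1)); first exact: omega_series_ndecr.
(* With [n = Y = K = 0] the tail bound reduces to a bound by 2 for all partial sums. *)
have := @omega_series_tail 0 0 0 N (fun k _ => omega_le_self k) (leq0n N).
rewrite !expr0 !mul1r !add0n {2}/u big_geq // add0r divr1.
by apply: le_trans; rewrite lerDl divr_ge0 ?ler0n ?exprn_ge0.
Qed.

Lemma omega_series_lim_tail n Y K :
  (forall k, (0 < k)%N -> (omega (n + k) <= Y + k)%N) ->
  0 <= t%:R ^+ n * (limn u - u (n + K).+1) <= (Y + K + 2)%:R / 2 ^+ K.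
Proof.
move=> HY; apply/andP; split.
  apply: mulr_ge0; first exact: ltW.
  by rewrite subr_ge0; apply: nondecreasing_cvgn_le;
    [apply: omega_series_ndecr|apply: omega_series_cvg].
rewrite -ler_pdivlMl // lerBlDr; apply: limr_le; first exact: omega_series_cvg.
exists (n + K).+1 => // N /= KN.
have -> : N = (n + (N.-1 - n)).+1 by lia.
have KN' : (K <= N.-1 - n)%N by lia.
have := @omega_series_tail n Y K _ HY KN'; set v := u _.+1; set w := u _.+1 => H.
rewrite -lerBlDr ler_pdivlMl // mulrBr lerBlDr [leRHS]addrC.
by apply: le_trans H; rewrite lerDl divr_ge0 ?ler0n ?exprn_ge0.
Qed.

Lemma omega_series_nat n : exists z : nat, t%:R ^+ n * u n.+1 = z%:R.
Proof.
elim: n => [|n [z Hz]]; first by exists 0%N; rewrite /u big_geq // mulr0.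
exists (t * z + omega n.+1)%N; rewrite omega_seriesS mulrDr {1}exprS -mulrA Hz.
rewrite natrD natrM; congr (_ + _).
by rewrite mulrCA mulfV ?mulr1 // gt_eqF.
Qed.

(** The expansions of [T_n] and [T_0] differ by [t^(-k)] in each term, and by one more [t^(-k0)] at
    [k0]; the factor [t - 1] sums the geometric series without division. *)
Lemma omega_series_main n k0 K K' : (0 < k0)%N ->
  (forall k, (0 < k <= K)%N -> omega (n + k) = (omega k + 1 + (k == k0))%N) ->
  (K' <= K)%N ->
  (t%:R - 1) * (t%:R ^+ n * u (n + K').+1 - t%:R ^+ n * u n.+1 - u K'.+1)
   = 1 - t%:R ^- K' + (k0 <= K')%:R * ((t%:R - 1) * t%:R ^- k0).
Proof.
move=> k00 H; elim: K' => [|k IH] kK.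
  rewrite addn0 subrr sub0r /u big_geq // oppr0 mulr0 expr0 invr1 subrr.
  by rewrite leqNgt k00 mul0r addr0.
have {IH} := IH (ltnW kK).
have E : t%:R ^- k = t%:R * t%:R ^- k.+1 :> R.
  by rewrite exprS invfM mulVKf // gt_eqF.
have -> : (k0 <= k.+1)%:R * ((t%:R - 1) * t%:R ^- k0)
  = (k0 <= k)%:R * ((t%:R - 1) * t%:R ^- k0)
    + (k.+1 == k0)%:R * ((t%:R - 1) * t%:R ^- k.+1) :> R.
  rewrite leq_eqVlt ltnS eq_sym; case: eqP => [<-|_] /=.
    by rewrite ltnn mul0r add0r.
  by rewrite mul0r addr0.
rewrite [(n + k.+1)%N]addnS omega_series_shift omega_seriesS H // !natrD E.
move: (t%:R ^- k.+1) (_ * u _.+1) (_ * u n.+1) (u k.+1) => r v w x IH.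
transitivity ((t%:R - 1) * (v - w - x) + (t%:R - 1) * (1 + (k.+1 == k0)%:R) * r).
  by ring.
by rewrite IH; ring.
Qed.

(** Here [A1], [A2] are the tails of [T_n] and [T_0], [t1 = t - 1], [rK = t^(-K)] and [s = t^(-k0)].
    The errors stay below [t1 * s], so the bracket lies between 0 and [2 * t1 * s]. *)
Lemma between_0_1 (b t1 A1 A2 f r rK s : R) : 0 < b -> 1 <= t1 ->
  0 <= A1 <= f -> 0 <= A2 <= f -> 0 <= rK <= r -> f + r < s ->
  2 * b * t1 * s <= 1 ->
  0 < b * (t1 * (A1 - A2) - rK + t1 * s) < 1.
Proof.
move=> b0 t1_1 /andP[A10 A1f] /andP[A20 A2f] /andP[rK0 rKr] frs bts.
have r_t : r <= t1 * r by rewrite ler_peMl // (le_trans rK0).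
have t10 : 0 < t1 by lra.
have lo : t1 * (- f) <= t1 * (A1 - A2) by rewrite ler_pM2l //; lra.
have hi : t1 * (A1 - A2) <= t1 * f by rewrite ler_pM2l //; lra.
have st : t1 * (f + r) < t1 * s by rewrite ltr_pM2l.
rewrite mulrDr mulrN in lo st; apply/andP; split.
  by apply: mulr_gt0 => //; lra.
apply: (@lt_le_trans _ _ (b * (2 * (t1 * s)))).
  have tr0 : 0 <= t1 * r by apply: mulr_ge0; lra.
  by rewrite ltr_pM2l //; lra.
by apply: le_trans bts; rewrite le_eqVlt; apply/orP; left; apply/eqP; ring.
Qed.

End Irrationality.

Theorem theorem1 (R : realType) (tuples : prime_tuples_conjecture R)
    (t : nat) (ht : (2 <= t)%N) :
  @irrational R (limn (fun N : nat =>
    \sum_(1 <= n < N) ((omega n)%:R / t%:R ^+ n : R))).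
Proof.
set u := fun N : nat => _; move=> [q _ Eq].
set b := `|denq q|%N; set L := limn u in Eq.
have b0 : (0 < b)%N by rewrite absz_gt0 denq_neq0.
have bR : 0 < b%:R :> R by rewrite ltr0n.
have Eb : b%:R * L = (numq q)%:~R.
  rewrite -Eq /ratr mulrC pmulrn /b abszE gtr0_norm ?denq_gt0 //.
  by rewrite divfK // intr_eq0 denq_neq0.
have t0 : (0 < t)%N by apply: leq_trans ht.
have tR : 0 < t%:R :> R by rewrite ltr0n.
(* The choice [k0 = 2 b t] works since [2 b (t - 1) < 2 b t < t^(2 b t)]. *)
have k00 : (0 < 2 * b * t)%N by rewrite !muln_gt0 b0 t0.
have [K [Y [n [kK KY main small]]]] :=
  good_shift R _ (t ^ (2 * b * t)) tuples k00.
have [z Ez] := omega_series_nat R t ht n.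
have E := omega_series_main R t ht _ _ _ _ k00 main (leqnn K).
rewrite kK mul1r Ez in E.
have A1 := omega_series_lim_tail R t ht _ _ K small.
have small0 k : (0 < k)%N -> (omega (0 + k) <= Y + k)%N.
  by move=> _; rewrite add0n (leq_trans (omega_le_self k)) // leq_addl.
have A2 := omega_series_lim_tail R t ht _ _ K small0.
rewrite add0n expr0 mul1r in A2.
rewrite -/(u _) -/u -/L in A1; rewrite -/(u K.+1) -/u -/L in A2; rewrite -!/(u _) in E.
have t1 : 1 <= t%:R - 1 :> R by rewrite lerBrDr -(natrD _ 1 1) ler_nat.
have rK : 0 <= (t%:R ^- K : R) <= (2 ^- K : R).
  rewrite invr_ge0 exprn_ge0 ?ler0n //= lef_pV2 ?posrE ?exprn_gt0 //.
  by apply: lerXn2r; rewrite ?nnegrE ?ler0n ?ler_nat.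
(* This is the inequality for [C = t^k0]; the 3 in [Y + K + 3] includes 1 for the term [2^(-K)]. *)
have frs : (Y + K + 2)%:R / 2 ^+ K + 2 ^- K < t%:R ^- (2 * b * t) :> R.
  rewrite -[X in _ + X]mul1r -mulrDl natr1 -addnS.
  rewrite ltr_pdivrMr ?exprn_gt0 // ltr_pdivlMl ?exprn_gt0 //.
  by rewrite -!natrX -natrM ltr_nat.
have bts : 2 * b%:R * (t%:R - 1) * t%:R ^- (2 * b * t) <= 1 :> R.
  rewrite ler_pdivrMr ?exprn_gt0 // mul1r.
  apply: (@le_trans _ _ (2 * b * t)%:R).
    by rewrite !natrM ler_pM2l ?mulr_gt0 // lerBlDr lerDl.
  by rewrite -natrX ler_nat ltnW // ltn_expl.
have /andP[] := between_0_1 _ _ _ _ _ _ _ _ _ bR t1 A1 A2 rK frs bts.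
set W := b%:R * _.
(* By [E] the truncations at [K] cancel, leaving [W = b ((t - 1) (t^n L - z - L) - 1)], an integer
   because [b L] is one. *)
have -> : W = (((t%:Z - 1) * ((t%:Z ^+ n - 1) * numq q - b%:Z * z%:Z) - b%:Z)%R)%:~R.
  rewrite !(rmorphB, rmorphM, rmorphXn, rmorph1) /= -!pmulrn -Eb /W.
  transitivity (b%:R * ((t%:R - 1) * (t%:R ^+ n * (L - u (n + K).+1) - (L - u K.+1))
    + (1 - t%:R ^- K + (t%:R - 1) * t%:R ^- (2 * b * t)) - 1) : R); first by ring.
  by rewrite -E; ring.
move: ((_ - b%:Z)%R) => m; rewrite ltr0z ltrz1; clear; lia.
Qed.
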